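(* Let $q$ be a prime power, let $k\ge 2$, and let $\mathfrak m=(m_1,\dots,m_k)$ and $\mathfrak n=(n_1,\dots,n_k)$ range over $k$-tuples of nonnegative integers. Then $$\lim_{m_{k-1},\,m_k\to\infty}\frac{P_k(\mathfrak m;\mathfrak n)}{N_k(\mathfrak m)N_k(\mathfrak n)}=1,$$ i.e. for every $\varepsilon>0$ there is $M$ such that $\Bigl|\frac{P_k(\mathfrak m;\mathfrak n)}{N_k(\mathfrak m)N_k(\mathfrak n)}-1\Bigr|<\varepsilon$ whenever $m_{k-1}\ge M$ and $m_k\ge M$ (with no restriction on the other coordinates of $\mathfrak m$ or on $\mathfrak n$).
   Context: $\mathbb F_q$ is the finite field with $q$ elements. Two polynomials in $\mathbb F_q[x_1,\dots,x_k]$ are identified if they differ by a factor in $\mathbb F_q^\times$; the classes are called normalized polynomials. The vector degree of a nonzero $f$ is $\operatorname{Deg} f=(\deg_{x_1}f,\dots,\deg_{x_k}f)$. For a $k$-tuple $\mathfrak m$ of nonnegative integers, $\mathcal N_k(\mathfrak m)$ is the set of normalized polynomials $f\in\mathbb F_q[x_1,\dots,x_k]$ with $\operatorname{Deg} f=\mathfrak m$, and $N_k(\mathfrak m)=|\mathcal N_k(\mathfrak m)|$. $P_k(\mathfrak m;\mathfrak n)=|\{(f,g)\in\mathcal N_k(\mathfrak m)\times\mathcal N_k(\mathfrak n):\gcd(f,g)=1\}|$. *)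

(* Defs.v *)
From HB Require Import structures.
From mathcomp Require Import all_boot all_order all_algebra finmap.
From mathcomp Require Import generic_quotient boolp classical_sets cardinality.
From mathcomp Require Import reals mpoly.

Set Implicit Arguments.
Unset Strict Implicit.
Unset Printing Implicit Defensive.

Import Order.TTheory GRing.Theory Num.Theory.
Local Open Scope classical_set_scope.
Local Open Scope quotient_scope.
Local Open Scope ring_scope.

Section NormalizedPolynomials.
Variables (F : finFieldType) (k : nat).
Implicit Types (p q f g d : {mpoly F[k]}) (m n : 'X_{1..k}).

Definition scale_eqv p q : bool := [exists c : F, (c != 0) && (p == c *: q)].

Lemma scale_eqvP p q :
  reflect (exists2 c : F, c != 0 & p = c *: q) (scale_eqv p q).
Proof.
apply: (iffP existsP) => [[c /andP[c0 /eqP->]]|[c c0 ->]]; first by exists c.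
by exists c; rewrite c0 /=.
Qed.

Lemma scale_eqv_refl : reflexive scale_eqv.
Proof. by move=> p; apply/scale_eqvP; exists 1; rewrite ?oner_eq0 ?scale1r. Qed.

Lemma scale_eqv_sym : ssrbool.symmetric scale_eqv.
Proof.
suff H p q : scale_eqv p q -> scale_eqv q p by move=> p q; apply/idP/idP; exact: H.
move=> /scale_eqvP[c c0 ->]; apply/scale_eqvP; exists c^-1; first by rewrite invr_eq0.
by rewrite scalerA mulVf // scale1r.
Qed.

Lemma scale_eqv_trans : transitive scale_eqv.
Proof.
move=> q p r /scale_eqvP[c c0 ->] /scale_eqvP[d d0 ->]; apply/scale_eqvP.
by exists (c * d); rewrite ?mulf_neq0 ?scalerA.
Qed.

Canonical scale_eqv_equiv :=
  EquivRel scale_eqv scale_eqv_refl scale_eqv_sym scale_eqv_trans.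

(* The class of 0 also belongs to this type. *)
Definition normpoly := {eq_quot scale_eqv}.

Lemma repr_normpoly p : exists2 c : F, c != 0 & repr (\pi_normpoly p) = c *: p.
Proof. by apply/scale_eqvP/(@eqmodP _ scale_eqv_equiv); exact: reprK. Qed.

Definition degx (i : 'I_k) p : nat := (\max_(a <- msupp p) a i)%N.

(* For p = 0 this is the zero tuple. *)
Definition vdeg p : 'X_{1..k} := [multinom degx i p | i < k].

Lemma vdegZ (c : F) p : c != 0 -> vdeg (c *: p) = vdeg p.
Proof.
move=> c0; apply/mnmP => i; rewrite !mnmE /degx.
by apply: perm_big; apply: msuppZ.
Qed.

Definition normset m : set normpoly :=
  [set u | repr u != 0 /\ vdeg (repr u) = m].

Lemma normset_pi m p : normset m (\pi_normpoly p) <-> p != 0 /\ vdeg p = m.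
Proof.
rewrite /normset /=; have [c c0 ->] := repr_normpoly p.
by rewrite mscalerI (negPf c0) vdegZ.
Qed.

Lemma finite_normset m : finite_set (normset m).
Proof.
pose b := (\sum_(i < k) m i).+1.
pose h (s : {ffun 'X_{1..k < b} -> F}) : normpoly :=
  \pi_normpoly (\sum_(a : 'X_{1..k < b}) s a *: 'X_[a]).
apply: (@sub_finite_set _ _ (h @` setT)); last exact: finite_image.
move=> u [_ vu]; exists [ffun a : 'X_{1..k < b} => (repr u)@_a] => //.
have /mpolywE E : (msize (repr u) <= b)%N.
  rewrite msizeE; apply/bigmax_leqP_seq => a au _.
  rewrite ltnS mdegE; apply: leq_sum => i _.
  by rewrite -vu mnmE; apply: leq_bigmax_seq.
rewrite /h -[RHS]reprK [in RHS]E; congr (\pi_normpoly _).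
by apply: eq_bigr => a _; rewrite ffunE.
Qed.

Definition mdvd d f : Prop := exists e, f = e * d.

Definition is_mgcd f g d : Prop :=
  [/\ mdvd d f, mdvd d g & forall e, mdvd e f -> mdvd e g -> mdvd e d].

Lemma mdvdZ (c : F) d f : c != 0 -> mdvd d (c *: f) <-> mdvd d f.
Proof.
move=> c0; split=> -[e He]; last by exists (c *: e); rewrite He scalerAl.
by exists (c^-1 *: e); rewrite -scalerAl -He scalerA mulVf // scale1r.
Qed.

Definition ncoprime (u v : normpoly) : Prop := is_mgcd (repr u) (repr v) 1.

Lemma ncoprime_pi f g :
  ncoprime (\pi_normpoly f) (\pi_normpoly g) <-> is_mgcd f g 1.
Proof.
rewrite /ncoprime.
have [c c0 ->] := repr_normpoly f; have [c' c'0 ->] := repr_normpoly g.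
split=> -[df dg H]; split; try by [apply/mdvdZ | apply/mdvdZ: df
  | apply/mdvdZ: dg | move: df => /mdvdZ; apply | move: dg => /mdvdZ; apply].
- by move=> e ef eg; apply: H; apply/mdvdZ.
- by move=> e /(mdvdZ _ _ c0) ef /(mdvdZ _ _ c'0) eg; apply: H.
Qed.

Definition Ncount m : nat := #|` fset_set (normset m)|.

Definition coprime_pairs m n : set (normpoly * normpoly) :=
  [set w | [/\ normset m w.1, normset n w.2 & ncoprime w.1 w.2]].

Lemma finite_coprime_pairs m n : finite_set (coprime_pairs m n).
Proof.
apply: (@sub_finite_set _ _ (normset m `*` normset n)); first by move=> w [].
by apply: finite_setX; apply: finite_normset.
Qed.

Definition Pcount m n : nat := #|` fset_set (coprime_pairs m n)|.

End NormalizedPolynomials.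

(* Main.v *)
Require Import Defs.
From HB Require Import structures.
From mathcomp Require Import all_boot all_order all_algebra finmap.
From mathcomp Require Import generic_quotient boolp classical_sets cardinality.
From mathcomp Require Import reals mpoly ring lra zify.

(* Write B(m) = prod_i (m_i + 1) for the number of monomials of vector degree at most m, and
   q = |F|.  Then N(m) >= q^(B(m) - 1), and there are at most q^B(m) polynomials of vector
   degree m.  A non-coprime pair is (a e, b e) with Deg e = t nonzero, Deg a = m - t and
   Deg b = n - t, so the number of such pairs is at most the sum over t of
   q^(B(t) + B(m - t) + B(n - t)).  Here B(t) + B(n - t) <= B(n) + 1, which removes every
   dependence on n, and B(m) - B(m - t) >= t_i prod_{j != i} (m_j + 1) for each i.  As two
   coordinates of m are at least k L, each of these products is at least k L; averaging over i
   gives B(m) - B(m - t) >= L |t|.  The proportion of non-coprime pairs is thus at most q^3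
   times the sum of q^(- L |t|) over t <> 0, which is at most 2^(k + 1) q^(- L) for L >= 1
   and so tends to 0 as L grows. *)

Set Implicit Arguments.
Unset Strict Implicit.
Unset Printing Implicit Defensive.

Import Order.TTheory GRing.Theory Num.Theory.
Local Open Scope ring_scope.

(** * Additivity of the vector degree *)

Section VectorDegree.
Variables (F : finFieldType) (k : nat).
Implicit Types (p q : {mpoly F[k]}) (m : 'X_{1..k}).

(* Substituting [T * 'X_i] for ['X_i] makes the partial degree in ['X_i] the degree in [T]. *)
Definition tagx (i : 'I_k) : {mpoly F[k]} -> {poly {mpoly F[k]}} :=
  mmap (polyC \o @mpolyC k F) (fun j => ('X_j)%:P * (if j == i then 'X else 1)).

Lemma tagxE i p :
  tagx i p = \sum_(a <- msupp p) (p@_a *: 'X_[a])%:P * 'X^(a i).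
Proof.
apply: eq_bigr => a _; rewrite /= /mmap1 -mul_mpolyC polyCM -mulrA; congr (_ * _).
have -> : 'X^(a i) = \prod_(j < k) (if j == i then 'X else 1 : {poly {mpoly F[k]}}) ^+ a j.
  rewrite (bigD1 i) //= eqxx big1 ?mulr1 // => j /negPf ->.
  by rewrite expr1n.
rewrite mpolyXE_id rmorph_prod -big_split; apply: eq_bigr => j _ /=.
by rewrite exprMn rmorphXn.
Qed.

Lemma tagxM i p q : tagx i (p * q) = tagx i p * tagx i q.
Proof. exact: rmorphM. Qed.

(** [T] only records the exponent [a i] while ['X_[a]] is kept whole, so distinct monomials of [p]
    never cancel. *)
Lemma mcoeff_tagx i p e a : ((tagx i p)`_e)@_a = p@_a *+ (a i == e).
Proof.
rewrite tagxE coef_sum raddf_sum /=.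
under eq_bigr => b _ do rewrite coefCM coefXn.
have [ap|ap] := boolP (a \in msupp p); last first.
  rewrite (memN_msupp_eq0 ap) mul0rn big_seq big1 // => b bp.
  case: (e == b i); rewrite ?mulr0 ?mcoeff0 // mulr1 mcoeffZ mcoeffX.
  by case: eqP ap bp => [->|]; rewrite ?mulr0 // => /negP.
rewrite (bigD1_seq a) ?msupp_uniq //= [X in _ + X]big1 ?addr0; last first.
  move=> b /negPf ba; case: (e == b i); rewrite ?mulr0 ?mcoeff0 // mulr1.
  by rewrite mcoeffZ mcoeffX ba mulr0.
rewrite eq_sym; case: (a i == e); rewrite ?mulr0 ?mcoeff0 // mulr1.
by rewrite mcoeffZ mcoeffX eqxx mulr1.
Qed.

Lemma size_tagx i p : p != 0 -> size (tagx i p) = (degx i p).+1.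
Proof.
move=> p0; apply/eqP; rewrite eqn_leq; apply/andP; split.
  apply/leq_sizeP => e le; apply/mpolyP => a; rewrite mcoeff_tagx mcoeff0.
  case: eqP => // ae; rewrite mulr1n; apply: memN_msupp_eq0; apply/negP => ap.
  by move: le; rewrite -ae ltnNge => /negP[]; apply: leq_bigmax_seq.
have lt a : a \in msupp p -> (a i < size (tagx i p))%N.
  rewrite mcoeff_msupp ltnNge; apply: contra => /(nth_default 0) /(congr1 (mcoeff a)).
  by rewrite mcoeff_tagx eqxx mcoeff0 mulr1n => ->.
have: (0 < size (tagx i p))%N by apply: leq_ltn_trans (lt _ (mlead_supp p0)).
case: (size _) lt => // e lt _; rewrite ltnS; apply/bigmax_leqP_seq => a ap _.
exact: lt.
Qed.

(** [tagx i] is multiplicative, and degrees in [T] add because the coefficient ring [{mpoly F[k]}]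
    is a domain. *)
Lemma vdegM p q : p != 0 -> q != 0 -> vdeg (p * q) = (vdeg p + vdeg q)%MM.
Proof.
move=> p0 q0; apply/mnmP => i; rewrite mnmDE !mnmE.
have sp := size_tagx i p0; have sq := size_tagx i q0.
have nz r : r != 0 -> tagx i r != 0 by move=> r0; rewrite -size_poly_eq0 size_tagx.
have : size (tagx i p * tagx i q) = (size (tagx i p) + size (tagx i q)).-1.
  exact: (size_mul (nz _ p0) (nz _ q0)).
rewrite -tagxM => /(etrans (esym (size_tagx i (mulf_neq0 p0 q0)))) E.
have := etrans E (congr1 predn (congr2 addn sp sq)).
by rewrite addSn addnS => -[].
Qed.

Lemma le_vdeg p a i : a \in msupp p -> (a i <= vdeg p i)%N.
Proof. by move=> ap; rewrite mnmE; apply: leq_bigmax_seq. Qed.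

(** Such a [p] is a nonzero constant, hence a unit. This forces [t] to be nonzero for a non-unit
    common divisor. *)
Lemma vdeg_eq0 p : p != 0 -> vdeg p = 0%MM -> mdvd p 1.
Proof.
move=> p0 v0; have pC : p = (p@_0)%:MP.
  apply/mpolyP => a; rewrite mcoeffC; case: eqP => [<-|/eqP]; rewrite ?mulr1 // mulr0.
  apply: contraNeq; rewrite -mcoeff_msupp => ap; apply/eqP/mnmP => i.
  by rewrite mnm0E; apply/eqP; rewrite -leqn0; have := le_vdeg i ap; rewrite v0 mnm0E.
exists ((p@_0)^-1)%:MP; rewrite [X in _ * X]pC -mpolyCM mulVf //.
by move: p0; rewrite {1}pC mpolyC_eq0.
Qed.

End VectorDegree.

(** * Cardinality bounds from surjections and injections *)

Section FiniteCounting.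
Local Open Scope classical_set_scope.

Lemma card_fset_set_le (T : finType) (U : choiceType) (A : set U) (h : T -> U) :
  A `<=` range h -> (#|` fset_set A| <= #|T|)%N.
Proof.
move=> Ah; have fh : finite_set (range h) by apply: finite_image.
rewrite (leq_trans (fsubset_leq_card (_ : (_ `<=` fset_set (range h))%fset))) //.
  by rewrite -fset_set_sub //; apply: sub_finite_set fh.
have -> : fset_set (range h) = [fset h x | x in T]%fset.
  apply/fsetP => u; rewrite in_fset_set //; apply/idP/imfsetP => /=.
    by rewrite inE => -[x _ <-]; exists x.
  by move=> [x _ ->]; rewrite inE; exists x.
by rewrite (leq_trans (leq_imfset_card _ _ _)) // -cardE.
Qed.

Lemma card_fset_set_ge (T : finType) (U : choiceType) (A : set U) (h : T -> U) :
  finite_set A -> injective h -> (forall x, A (h x)) -> (#|T| <= #|` fset_set A|)%N.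
Proof.
move=> fA ih hA; have -> : #|T| = #|` [fset h x | x in T]%fset|.
  by rewrite card_imfset // -cardE.
apply/fsubset_leq_card/fsubsetP => u /imfsetP[x _ ->].
by rewrite in_fset_set // inE.
Qed.

End FiniteCounting.

(** * Polynomials with exponents in a box, and the lower bound for [Ncount] *)

Section Boxes.
Variables (F : finFieldType) (k : nat).
Implicit Types (p q : {mpoly F[k]}) (m n : 'X_{1..k}).
Local Open Scope classical_set_scope.
Local Open Scope quotient_scope.

Definition box m : Type := {dffun forall i : 'I_k, 'I_(m i).+1}.
HB.instance Definition _ m := Finite.on (box m).

Definition boxmon m (s : box m) : 'X_{1..k} := [multinom (s i : nat) | i < k].

Lemma boxmon_inj m : injective (@boxmon m).
Proof.
move=> s t /mnmP st; apply/ffunP => i; apply: val_inj.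
by have := st i; rewrite !mnmE.
Qed.

(** Meaningful only for [a] inside the box; [inord] sends an exponent that is too large to 0. *)
Definition box_of m (a : 'X_{1..k}) : box m := [ffun i => inord (a i)].

Lemma boxmonK m (a : 'X_{1..k}) : (forall i, (a i <= m i)%N) -> boxmon (box_of m a) = a.
Proof. by move=> am; apply/mnmP => i; rewrite mnmE ffunE inordK // ltnS. Qed.

Definition boxsize m : nat := (\prod_(i < k) (m i).+1)%N.

Lemma card_box m : #|{: box m}| = boxsize m.
Proof.
rewrite card_dep_ffun foldrE big_image /=.
by apply: eq_bigr => i _; rewrite card_ord.
Qed.

Definition boxpoly m (c : {ffun box m -> F}) : {mpoly F[k]} :=
  \sum_s c s *: 'X_[boxmon s].

Lemma mcoeff_boxpoly m (c : {ffun box m -> F}) s : (boxpoly c)@_(boxmon s) = c s.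
Proof.
rewrite /boxpoly raddf_sum (bigD1 s) //= mcoeffZ mcoeffX eqxx mulr1 big1 ?addr0 //.
move=> t /negPf ts; rewrite mcoeffZ mcoeffX (inj_eq (@boxmon_inj m)) ts.
exact: mulr0.
Qed.

Lemma mcoeff_boxpoly_out m (c : {ffun box m -> F}) (a : 'X_{1..k}) :
  ~~ [forall i, a i <= m i]%N -> (boxpoly c)@_a = 0.
Proof.
move=> am; rewrite /boxpoly raddf_sum big1 // => s _ /=.
rewrite mcoeffZ mcoeffX; case: eqP => [sa|]; last by rewrite mulr0.
case/negP: am; apply/forallP => i; rewrite -sa mnmE.
by rewrite -ltnS.
Qed.

Lemma boxpolyP m p : (forall i, (vdeg p i <= m i)%N) ->
  exists c : {ffun box m -> F}, p = boxpoly c.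
Proof.
move=> pm; exists [ffun s => p@_(boxmon s)]; apply/mpolyP => a.
have [/forallP am|am] := boolP [forall i, a i <= m i]%N.
  by rewrite -(boxmonK am) mcoeff_boxpoly ffunE.
rewrite mcoeff_boxpoly_out //; apply: memN_msupp_eq0; apply: contra am => ap.
by apply/forallP => i; apply: leq_trans (le_vdeg i ap) (pm i).
Qed.

(** The corner monomial ['X_[m]] alone attains the maximal degree in every variable. *)
Lemma vdeg_boxpoly m (c : {ffun box m -> F}) :
  c (box_of m m) != 0 -> boxpoly c != 0 /\ vdeg (boxpoly c) = m.
Proof.
move=> c0; have ms : m \in msupp (boxpoly c).
  by rewrite mcoeff_msupp -[X in _@_X](@boxmonK m m) // mcoeff_boxpoly.
split; first by apply: contraTneq ms => ->; rewrite msupp0.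
apply/mnmP => i; apply/eqP; rewrite eqn_leq le_vdeg // andbT mnmE.
apply/bigmax_leqP_seq => a ap _; move: ap; rewrite mcoeff_msupp.
by apply: contraR => am; apply/eqP/mcoeff_boxpoly_out; apply: contra am => /forallP.
Qed.

(* Polynomials whose coefficient at the exponent [m] is 1 are pairwise inequivalent. *)
Lemma Ncount_ge m : (#|F| ^ (boxsize m).-1 <= Ncount F m)%N.
Proof.
pose top := box_of m m.
pose ext (c : {ffun {s : box m | s != top} -> F}) : {ffun box m -> F} :=
  [ffun s => if insub s is Some s' then c s' else 1].
have ext_top c : ext c top = 1 by rewrite ffunE insubF // eqxx.
have <- : #|{ffun {s : box m | s != top} -> F}| = (#|F| ^ (boxsize m).-1)%N.
  by rewrite card_ffun card_sig -card_box cardC1.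
apply: (@card_fset_set_ge _ _ _ (fun c => \pi_(normpoly F k) (boxpoly (ext c)))).
- exact: finite_normset.
- move=> c c' /eqP; rewrite (@eqmodE _ (scale_eqv_equiv F k)) => /scale_eqvP[x x0 E].
  have /eqP x1 : x == 1.
    move/(congr1 (mcoeff (boxmon top))): E.
    by rewrite mcoeffZ !mcoeff_boxpoly !ext_top mulr1 => <-.
  apply/ffunP => s; move/(congr1 (mcoeff (boxmon (val s)))): E.
  by rewrite x1 scale1r !mcoeff_boxpoly !ffunE valK.
- by move=> c; apply/normset_pi/vdeg_boxpoly; rewrite ext_top oner_neq0.
Qed.

End Boxes.

(** * Union bound for a covering by parametrized families *)

Section FiniteCovering.
Local Open Scope classical_set_scope.

(** Index and parameter are bundled into one dependent sum, so that the whole covering is the range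
    of a single map. *)
Lemma card_fset_set_cover (I : finType) (P : pred I) (T : I -> finType) (U : choiceType)
    (A : set U) (h : forall i, T i -> U) :
  (forall u, A u -> exists i, P i /\ range (@h i) u) ->
  (#|` fset_set A| <= \sum_(i | P i) #|T i|)%N.
Proof.
move=> Ah; pose hP (x : {i : {i | P i} & T (val i)}) := h (val (tag x)) (tagged x).
apply: leq_trans (@card_fset_set_le _ _ A hP _) _.
  move=> u /Ah[i [Pi [x _ <-]]].
  by exists (Tagged (fun i : {i | P i} => T (val i)) (x : T (val (exist _ i Pi)))).
by rewrite card_tagged sumnE big_map big_enum (big_sub P (fun i => #|T i|)).
Qed.

End FiniteCovering.

(** * Inequalities between box sizes *)

Section BoxArithmetic.
Variable k : nat.
Implicit Types m n t : 'X_{1..k}.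

Lemma boxsize_gt0 m : (0 < boxsize m)%N.
Proof. by rewrite /boxsize prodn_gt0. Qed.

(* The boxes [0, m] and m + [0, n] lie in [0, m + n] and meet only in m. *)
Lemma boxsizeD m n : (boxsize m + boxsize n <= (boxsize (m + n)%MM).+1)%N.
Proof.
(* Positivity of both partial products is carried along, since the induction over the coordinates
   uses it. *)
have [_ _] : [/\ 0 < boxsize m, 0 < boxsize n &
    boxsize m + boxsize n <= (boxsize (m + n)%MM).+1]%N; last by [].
rewrite /boxsize; elim/big_rec3: _ => // i x y z _ [x0 y0 le].
rewrite mnmDE; move: (m i) (n i) => a b; split; rewrite ?muln_gt0 //.
have := leq_mul (leqnn (a + b).+1) le.
have := leq_mul (leqnn a) y0; have := leq_mul (leqnn b) x0.
lia.
Qed.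

(** Split the factor at [i] as [(m i - t i + 1) + t i]; the other factors only shrink on passing to
    [m - t]. *)
Lemma boxsizeB m t (A : nat) (i : 'I_k) : (t <= m)%MM ->
  (A <= \prod_(j < k | j != i) (m j).+1)%N ->
  (boxsize (m - t)%MM + A * t i <= boxsize m)%N.
Proof.
move=> /mnm_lepP tm Am; rewrite /boxsize [X in (X + _ <= _)%N](bigD1 i) //=.
rewrite [X in (_ <= X)%N](bigD1 i) //= mnmBE.
set B := (\prod_(j < k | j != i) (m j).+1)%N in Am *.
have : (\prod_(j < k | j != i) ((m - t)%MM j).+1 <= B)%N.
  by apply: leq_prod => j _; rewrite mnmBE; lia.
have -> : ((m i).+1 = (m i - t i).+1 + t i)%N by have := tm i; lia.
move=> le; rewrite mulnDl leq_add ?leq_mul2l ?le ?orbT //.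
by rewrite mulnC leq_mul2l Am orbT.
Qed.

Lemma boxsizeB_mdeg m t (L : nat) : (t <= m)%MM ->
  (forall i : 'I_k, k * L <= \prod_(j < k | j != i) (m j).+1)%N ->
  (boxsize (m - t)%MM + L * mdeg t <= boxsize m)%N.
Proof.
move=> tm Lm; have [k0|k0] := posnP k.
  rewrite mdegE /boxsize !big1 ?muln0 // => i; have := ltn_ord i; lia.
(* After multiplication by [k], the claim is the sum over [i] of [boxsizeB] with [A = k * L]. *)
rewrite -(leq_pmul2l k0) mulnDr mulnA mdegE big_distrr /=.
have kE B : (k * B = \sum_(i < k) B)%N by rewrite sum_nat_const card_ord.
rewrite (kE (boxsize m)) (kE (boxsize (m - t)%MM)).
rewrite -big_split /=; apply: leq_sum => i _; exact: boxsizeB.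
Qed.

End BoxArithmetic.

(** * Counting non-coprime pairs by the degree of a common divisor *)

Section NonCoprimePairs.
Variables (F : finFieldType) (k : nat).
Implicit Types (m n t : 'X_{1..k}) (w : normpoly F k * normpoly F k).
Local Open Scope classical_set_scope.
Local Open Scope quotient_scope.

Definition noncoprime_pairs m n : set (normpoly F k * normpoly F k) :=
  [set w | [/\ normset m w.1, normset n w.2 & ~ ncoprime w.1 w.2]].

Lemma card_noncoprime_pairs m n :
  (Pcount F m n + #|` fset_set (noncoprime_pairs m n)| = Ncount F m * Ncount F n)%N.
Proof.
pose X := normset m `*` normset n : set (normpoly F k * normpoly F k).
have fX : finite_set X by apply: finite_setX; apply: finite_normset.
have fC : finite_set (coprime_pairs m n) := finite_coprime_pairs F m n.
have XC : X `&` coprime_pairs m n = coprime_pairs m n.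
  by rewrite setIidr // => w [].
have XD : X `\` coprime_pairs m n = noncoprime_pairs m n.
  apply/seteqP; split=> w /=; first by move=> [[mw nw] cw]; split=> // c; apply: cw.
  by move=> [mw nw cw]; split=> // -[].
rewrite /Pcount -XC -XD fset_setI // fset_setD // cardfsID.
rewrite /Ncount !cardfE -card_prod.
(* [h] is a bijection onto [X], so both cardinality bounds apply to it. *)
pose h (x : fset_set (normset (F := F) m) * fset_set (normset (F := F) n)) := (val x.1, val x.2).
apply/eqP; rewrite eqn_leq -cardfE (@card_fset_set_le _ _ _ h) /= ?(@card_fset_set_ge _ _ _ h) //.
- by move=> [x y] [x' y'] [/val_inj-> /val_inj->].
- move=> [x y]; split=> /=.
    by have := valP x; rewrite in_fset_set ?inE //; apply: finite_normset.
  by have := valP y; rewrite in_fset_set ?inE //; apply: finite_normset.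
- move=> [u v] [mu nv].
  have mu' : u \in fset_set (normset (F := F) m).
    by rewrite in_fset_set ?inE //; apply: finite_normset.
  have nv' : v \in fset_set (normset (F := F) n).
    by rewrite in_fset_set ?inE //; apply: finite_normset.
  by exists ([` mu']%fset, [` nv']%fset).
Qed.

(** Coding exponents by functions into ['I_b] gives a finite index type over which sums of products
    factor. *)
Definition mnm_of b (t : {ffun 'I_k -> 'I_b}) : 'X_{1..k} := [multinom (t i : nat) | i < k].

Lemma card_noncoprime_pairs_le b m n : (forall i, (m i < b)%N) ->
  (#|` fset_set (noncoprime_pairs m n)| <=
   \sum_(t : {ffun 'I_k -> 'I_b} |
         [&& mnm_of t != 0%MM, (mnm_of t <= m)%MM & (mnm_of t <= n)%MM])
     #|F| ^ (boxsize (mnm_of t) + boxsize (m - mnm_of t)%MM + boxsize (n - mnm_of t)%MM))%N.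
Proof.
move=> mb; pose C m' := {ffun box m' -> F} : finType.
have cardC m' : #|C m'| = (#|F| ^ boxsize m')%N by rewrite card_ffun card_box.
under eq_bigr => t _ do rewrite !expnD -!cardC -!card_prod.
(* [x.1.1] codes the common divisor, [x.1.2] and [x.2] the two cofactors. *)
pose h (t : {ffun 'I_k -> 'I_b})
    (x : C (mnm_of t) * C (m - mnm_of t)%MM * C (n - mnm_of t)%MM) :=
  (\pi_(normpoly F k) (boxpoly x.1.2 * boxpoly x.1.1),
   \pi_(normpoly F k) (boxpoly x.2 * boxpoly x.1.1)).
apply: (card_fset_set_cover (h := h)) => -[u v] [/= mu nv nc].
(* As 1 divides everything, it fails to be a gcd only if some common divisor is not a unit. *)
have [e [[f fE] [g gE] e1]] :
    exists e, [/\ mdvd e (repr u), mdvd e (repr v) & ~ mdvd e 1].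
  apply: contrapT => H; apply: nc; split; [by exists (repr u); rewrite mulr1
    | by exists (repr v); rewrite mulr1 |] => e eu ev.
  by apply: contrapT => e1; apply: H; exists e.
have [] := mu; rewrite fE mulf_eq0 negb_or => /andP[f0 e0] mE.
have [] := nv; rewrite gE mulf_eq0 negb_or => /andP[g0 _] nE.
rewrite !vdegM // in mE nE.
have eb i : (vdeg e i < b)%N by apply: leq_ltn_trans (mb i); rewrite -mE mnmDE leq_addl.
pose t : {ffun 'I_k -> 'I_b} := [ffun i => Ordinal (eb i)].
have tE : mnm_of t = vdeg e by apply/mnmP => i; rewrite mnmE ffunE.
exists t; split.
  rewrite tE -{1}mE -nE !lem_addl ?andbT //.
  by apply/eqP => v0; apply: e1; apply: vdeg_eq0.
have [ce eE] : exists c : C (mnm_of t), e = boxpoly c.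
  by apply: boxpolyP => i; rewrite tE.
have [cf fE'] : exists c : C (m - mnm_of t)%MM, f = boxpoly c.
  by apply: boxpolyP => i; rewrite tE -mE addmK.
have [cg gE'] : exists c : C (n - mnm_of t)%MM, g = boxpoly c.
  by apply: boxpolyP => i; rewrite tE -nE addmK.
by exists (ce, cf, cg); rewrite // /h /= -eE -fE' -gE' -fE -gE !reprK.
Qed.

End NonCoprimePairs.

(** * Tail of a multiple geometric series *)

Section GeometricTail.
Variable R : realFieldType.
Implicit Types x y : R.

(** Induction by [S_(b+1) = 1 + x * S_b], since [x * (1 + 2 * x) <= 2 * x]. *)
Lemma geometric_le x b : 0 <= x -> 2 * x <= 1 -> \sum_(j < b) x ^+ j <= 1 + 2 * x.
Proof.
move=> x0 x1; elim: b => [|b IH]; first by rewrite big_ord0; lra.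
rewrite big_ord_recl expr0 lerD2l.
under eq_bigr => j _ do rewrite /bump /= exprS.
by rewrite -mulr_sumr mulrC; apply: ler_wpM2r => //; lra.
Qed.

(** By convexity the power lies below its chord over [[0, 1]]. *)
Lemma expr1D_le y k : 0 <= y -> y <= 1 -> (1 + y) ^+ k <= 1 + (2 ^+ k - 1) * y.
Proof.
move=> y0 y1; elim: k => [|k IH]; first by rewrite !expr0; lra.
have : 1 <= 2 ^+ k :> R by apply: exprn_ege1; lra.
rewrite !exprS; move: (2 ^+ k : R) ((1 + y) ^+ k) IH => c z le c1.
apply: le_trans (ler_wpM2l _ le) _; first by lra.
(* This is the new chord [1 + (2 * c - 1) * y] minus [(1 + y) * (1 + (c - 1) * y)]. *)
have : 0 <= (c - 1) * (y * (1 - y)) by rewrite !mulr_ge0 //; lra.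
lra.
Qed.

(** The sum over all [t] is the [k]-th power of a geometric sum; its term at [t = 0] cancels the 1
    in the chord bound at [y = 2 * x]. *)
Lemma multigeometric_tail_le x k b : 0 <= x -> 2 * x <= 1 -> (0 < b)%N ->
  \sum_(t : {ffun 'I_k -> 'I_b} | mnm_of t != 0%MM) x ^+ mdeg (mnm_of t) <= 2 ^+ k * (2 * x).
Proof.
case: b => // b x0 x1 _.
have xdeg (t : {ffun 'I_k -> 'I_b.+1}) : x ^+ mdeg (mnm_of t) = \prod_(i < k) x ^+ t i.
  by rewrite mdegE -prodrXr; apply: eq_bigr => i _; rewrite mnmE.
have : (1 + 2 * x) ^+ k <= 1 + (2 ^+ k - 1) * (2 * x) by apply: expr1D_le; lra.
have : (\sum_(j < b.+1) x ^+ j) ^+ k <= (1 + 2 * x) ^+ k.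
  by rewrite lerXn2r ?nnegrE ?geometric_le ?sumr_ge0 // => *; rewrite ?exprn_ge0 //; lra.
have -> : (\sum_(j < b.+1) x ^+ j) ^+ k = \sum_(t : {ffun 'I_k -> 'I_b.+1}) x ^+ mdeg (mnm_of t).
  under [RHS]eq_bigr => t _ do rewrite xdeg.
  by rewrite -(bigA_distr_bigA (fun=> fun j : 'I_b.+1 => x ^+ j)) prodr_const card_ord.
rewrite (bigD1 [ffun=> ord0]) //=.
have -> : mnm_of [ffun=> ord0 : 'I_b.+1] = 0%MM :> 'X_{1..k}.
  by apply/mnmP => i; rewrite mnmE ffunE mnm0E.
rewrite mdeg0 expr0.
rewrite (eq_bigl (fun t : {ffun 'I_k -> 'I_b.+1} => mnm_of t != 0%MM)); last first.
  move=> t; congr (~~ _); apply/eqP/eqP => [->|/mnmP t0].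
    by apply/mnmP => i; rewrite mnmE ffunE mnm0E.
  by apply/ffunP => i; apply: val_inj; have := t0 i; rewrite mnmE mnm0E ffunE.
by move: (\sum_(t | _) _) => S; lra.
Qed.

End GeometricTail.

(** * The proportion of non-coprime pairs and the limit *)

Lemma card_noncoprime_pairs_ratio (R : realFieldType) (F : finFieldType) (k L : nat)
    (m n : 'X_{1..k}) :
  (0 < L)%N ->
  (forall i : 'I_k, k * L <= \prod_(j < k | j != i) (m j).+1)%N ->
  (#|` fset_set (noncoprime_pairs (F := F) m n)|%:R : R) <=
    #|F|%:R ^+ 3 * 2 ^+ k.+1 / #|F|%:R ^+ L * ((Ncount F m)%:R * (Ncount F n)%:R).
Proof.
move=> L0 Lm; set q : R := #|F|%:R.
have q2 : 2 <= q by rewrite ler_nat card_finNzRing_gt1.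
have q0 : 0 < q by lra.
have q1 : 1 <= q by lra.
pose x := (q ^+ L)^-1; have x0 : 0 <= x by rewrite invr_ge0 exprn_ge0 // ltW.
have x1 : 2 * x <= 1.
  rewrite ler_pdivrMr ?exprn_gt0 // mul1r (le_trans q2) //.
  by rewrite -{1}(expr1 q) ler_weXn2l.
pose b := (\sum_(i < k) m i).+1.
have mb i : (m i < b)%N by rewrite ltnS (bigD1 i) //= leq_addr.
pose Q := q ^+ 3 * ((Ncount F m)%:R * (Ncount F n)%:R).
have Q0 : 0 <= Q by rewrite !mulr_ge0 ?exprn_ge0 // ltW.
(* Of the three factors [q] in [Q], two make up for the predecessors in [Ncount_ge] and one for the
   successor in [boxsizeD]. *)
have Qge : q ^+ (boxsize m + boxsize n).+1 <= Q.
  have -> : (boxsize m + boxsize n).+1 = (3 + ((boxsize m).-1 + (boxsize n).-1))%N.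
    by have := boxsize_gt0 m; have := boxsize_gt0 n; lia.
  rewrite !exprD; apply: ler_wpM2l; first by rewrite exprn_ge0 // ltW.
  by apply: ler_pM; rewrite ?exprn_ge0 ?(ltW q0) // /q -natrX ler_nat Ncount_ge.
have -> : q ^+ 3 * 2 ^+ k.+1 / q ^+ L * ((Ncount F m)%:R * (Ncount F n)%:R)
    = 2 ^+ k * (2 * x) * Q.
  rewrite [2 ^+ _]exprS -[_^-1]/x /Q; move: (2 ^+ k) (q ^+ 3) (_ * _%:R) => a c N.
  by ring.
have D := @card_noncoprime_pairs_le F k b m n mb.
rewrite -(ler_nat R) natr_sum in D; apply: le_trans D _.
apply: (@le_trans _ _ (\sum_(t : {ffun 'I_k -> 'I_b} | mnm_of t != 0%MM)
    x ^+ mdeg (mnm_of t) * Q)); last first.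
  by rewrite -mulr_suml ler_wpM2r // multigeometric_tail_le.
(* The terms with [t] not below both [m] and [n] are nonnegative and only enlarge the bound. *)
rewrite [leRHS](bigID (fun t => (mnm_of t <= m)%MM && (mnm_of t <= n)%MM)) /=.
rewrite -[leLHS]addr0; apply: lerD; last first.
  by apply: sumr_ge0 => t _; rewrite mulr_ge0 ?exprn_ge0.
apply: ler_sum => t /and3P[_ tm tn]; move: (mnm_of t) tm tn => {}t tm tn.
rewrite natrX -/q /x exprVn -exprM mulrC ler_pdivlMr ?exprn_gt0 // -exprD.
apply: le_trans Qge; rewrite ler_weXn2l //.
have := boxsizeB_mdeg tm Lm; have := boxsizeD t (n - t)%MM.
by rewrite addmC submK //; lia.
Qed.

Theorem theorem5p5 (R : realType) (F : finFieldType) (k : nat) (hk : (2 <= k)%N) :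
  forall eps : R, 0 < eps ->
  exists M : nat, forall m n : 'X_{1..k},
    (forall i : 'I_k, i = k.-2 :> nat \/ i = k.-1 :> nat -> (M <= m i)%N) ->
    `| (Pcount F m n)%:R / ((Ncount F m)%:R * (Ncount F n)%:R) - 1 | < eps.
Proof.
move=> eps eps0; set q : R := #|F|%:R.
have qgt1 : (1 < #|F|)%N := card_finNzRing_gt1 F.
have q0 : 0 < q by rewrite ltr0n ltnW.
(* [L] is chosen so that [C / eps < L < q ^+ L]. *)
pose C := q ^+ 3 * 2 ^+ k.+1; pose L := (Num.trunc (C / eps)).+1.
have CL : C / q ^+ L < eps.
  rewrite ltr_pdivrMr ?exprn_gt0 // mulrC -ltr_pdivrMr //.
  apply: lt_trans (truncnS_gt _) _.
  by rewrite /q -natrX ltr_nat ltn_expl.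
exists (k * L)%N => m n mM.
have Lm (i : 'I_k) : (k * L <= \prod_(j < k | j != i) (m j).+1)%N.
  (* Whichever [i] is omitted, one of the two large coordinates stays in the product. *)
  have [j [ji jk]] : exists j : 'I_k, j != i /\ (j = k.-2 :> nat \/ j = k.-1 :> nat).
    have k2 : (k.-2 < k)%N by lia.
    have k1 : (k.-1 < k)%N by lia.
    have [ik|ik] := eqVneq (val i) k.-1.
      by exists (Ordinal k2); split; [rewrite -val_eqE /= ik; lia | left].
    by exists (Ordinal k1); split; [rewrite -val_eqE eq_sym | right].
  rewrite (bigD1 j) //=; apply: leq_trans (leqW (mM j jk)) _.
  by rewrite leq_pmulr // prodn_gt0.
have N0 (m' : 'X_{1..k}) : 0 < (Ncount F m')%:R :> R.
  by rewrite ltr0n; apply: leq_trans (Ncount_ge F m'); rewrite expn_gt0 ltnW.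
have D := card_noncoprime_pairs_ratio R F n (isT : 0 < L)%N Lm.
set N := (Ncount F m)%:R * (Ncount F n)%:R in D *.
have N1 : 0 < N by rewrite mulr_gt0.
have -> : (Pcount F m n)%:R / N - 1 = - (#|` fset_set (noncoprime_pairs (F := F) m n)|%:R / N).
  apply: (mulIf (lt0r_neq0 N1)); rewrite mulrBl mulNr !divfK ?lt0r_neq0 // mul1r.
  by rewrite /N -natrM -card_noncoprime_pairs natrD; ring.
rewrite normrN ger0_norm ?divr_ge0 ?(ltW N1) // ltr_pdivrMr //.
by apply: le_lt_trans D _; rewrite ltr_pM2r.
Qed.
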